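(* Let $K$ be a field and let $A$ be a finite dimensional Frobenius cellular $K$-algebra with cell datum $(\Lambda,M,C,i)$ and a fixed non-degenerate associative bilinear form $f$, such that the left dual basis $\{D_{S,T}^\lambda\}$ and right dual basis $\{d_{S,T}^\lambda\}$ of the cellular basis satisfy $i(D_{S,T}^\lambda)=D_{T,S}^\lambda$ and $i(d_{S,T}^\lambda)=d_{T,S}^\lambda$ for all $\lambda\in\Lambda$ and $S,T\in M(\lambda)$. Then, for $\lambda\in\Lambda$, the cell module $W_C(\lambda)$ is projective if and only if $k_\lambda\neq 0$.
   Context: All modules are left modules. Cellular algebra: an associative unital $K$-algebra $A$ is cellular with cell datum $(\Lambda,M,C,i)$ if (C1) $\Lambda$ is a finite poset, to each $\lambda\in\Lambda$ is attached a finite set $M(\lambda)$, and $A$ has a $K$-basis $\{C_{S,T}^\lambda\mid\lambda\in\Lambda,\ S,T\in M(\lambda)\}$; (C2) $i$ is a $K$-linear anti-automorphism of $A$ with $i^2=\mathrm{id}$ and $i(C_{S,T}^\lambda)=C_{T,S}^\lambda$; (C3) for $\lambda\in\Lambda$, $S,T\in M(\lambda)$, $a\in A$, one has $aC_{S,T}^\lambda\equiv\sum_{S'\in M(\lambda)}r_a(S',S)C_{S',T}^\lambda \pmod{A(<\lambda)}$, where $r_a(S',S)\in K$ is independent of $T$ and $A(<\lambda)$ is the span of all $C_{U,V}^\mu$ with $\mu<\lambda$, $U,V\in M(\mu)$. Cell module: $W_C(\lambda)$ has $K$-basis $\{C_S\mid S\in M(\lambda)\}$ and action $aC_S=\sum_{S'\in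 M(\lambda)}r_a(S',S)C_{S'}$. The scalars $\Phi(T,U)$, $T,U\in M(\lambda)$, are defined by $C_{S,T}^\lambda C_{U,V}^\lambda\equiv\Phi(T,U)C_{S,V}^\lambda\pmod{A(<\lambda)}$ (they depend only on $T,U$). Frobenius: $A$ has a non-degenerate bilinear form $f:A\times A\to K$ that is associative, $f(ab,c)=f(a,bc)$; put $\tau(a)=f(a,1)$. The left dual basis is determined by $\tau(D_{U,V}^\mu C_{S,T}^\lambda)=\delta_{\lambda\mu}\delta_{SV}\delta_{TU}$ and the right dual basis by $\tau(C_{S,T}^\lambda d_{U,V}^\mu)=\delta_{\lambda\mu}\delta_{SV}\delta_{TU}$. Let $A_D(>\lambda)$ be the span of all $D_{X,Y}^\epsilon$ with $\epsilon>\lambda$, $X,Y\in M(\epsilon)$. It is a fact that for $S,T,P,Q\in M(\lambda)$ one has $D_{S,T}^\lambda D_{P,Q}^\lambda\equiv\Psi(T,P)D_{S,Q}^\lambda\pmod{A_D(>\lambda)}$ with $\Psi(T,P)\in K$ depending only on $T$ and $P$; this defines $\Psi$. The constant $k_\lambda$: choose any $T\in M(\lambda)$ (so $M(\lambda)$ is nonempty) and set $k_\lambda=\sum_{X\in M(\lambda)}\Phi(X,T)\Psi(X,T)$; under the stated hypotheses this does not depend on the choice of $T$. *)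

(* Defs.v *)
From HB Require Import structures.
From mathcomp Require Import all_boot all_order all_algebra all_field.
From mathcomp Require Import boolp classical_sets.

Set Implicit Arguments.
Unset Strict Implicit.
Unset Printing Implicit Defensive.

Import Order.TTheory GRing.Theory.
Local Open Scope ring_scope.

Section FamilyTheory.
Variables (K : fieldType) (V : vectType K) (I : finType) (b : I -> V).

Lemma span_familyP (P : pred I) v :
  reflect (exists c : I -> K, v = \sum_(x | P x) c x *: b x)
          (v \in <<[seq b x | x in P]>>%VS).
Proof.
rewrite span_def big_image /=; apply: (iffP memv_sumP) => [[w wP ->]|[c ->]].
  have h x : exists k, P x ==> (w x == k *: b x).
    case Px: (P x) => /=; last by exists 0.
    by have /vlineP[k ->] := wP x Px; exists k.
  exists (fun x => xchoose (h x)); apply: eq_bigr => x Px.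
  by have /implyP/(_ Px)/eqP := xchooseP (h x).
by exists (fun x => c x *: b x) => // x _; rewrite memvZ ?memv_line.
Qed.

Lemma mem_span_family (P : pred I) x : P x -> b x \in <<[seq b x | x in P]>>%VS.
Proof. by move=> Px; rewrite memv_span ?map_f ?mem_enum. Qed.

Definition coef_free :=
  forall c : I -> K, \sum_x c x *: b x = 0 -> forall x, c x = 0.

Lemma free_coef_free : free [seq b x | x : I] -> coef_free.
Proof.
move=> fb c c0 x; rewrite -(enum_rankK x).
have /freeP/(_ (fun i => c (enum_val i))) : free (image_tuple b I) by [].
apply; rewrite -[RHS]c0 [RHS](reindex (@enum_val I I)) /=; last first.
  exact/onW_bij/enum_val_bij.
apply: eq_bigr => i _; congr (_ *: _).
by rewrite (nth_map (enum_val i)) -?cardE // -enum_val_nth.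
Qed.

Lemma free_family_span (P : pred I) (c : I -> K) :
    coef_free ->
    \sum_x c x *: b x \in <<[seq b x | x in P]>>%VS ->
  forall x, ~~ P x -> c x = 0.
Proof.
move=> fb /span_familyP[e]; rewrite [RHS]big_mkcond /= => ce x nPx.
have := fb (fun x => c x - (if P x then e x else 0)).
move/(_ _ x); rewrite (negPf nPx) subr0; apply.
apply/eqP; under eq_bigr do rewrite scalerBl.
rewrite big_split /= sumrN subr_eq0 ce; apply/eqP/eq_bigr => y _.
by case: ifP => // _; rewrite scale0r.
Qed.

Lemma free_subfamily_span (J : finType) (h : J -> I) (P : pred I) (c : J -> K) :
    coef_free -> injective h -> (forall j, ~~ P (h j)) ->
    \sum_j c j *: b (h j) \in <<[seq b x | x in P]>>%VS ->
  forall j, c j = 0.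
Proof.
move=> fb hI nP cP j.
pose c' x := \sum_(i | h i == x) c i.
have <- : c' (h j) = c j.
  by rewrite /c' (big_pred1 j) // => i; rewrite /= (inj_eq hI).
apply: free_family_span (nP j) => //.
rewrite [X in X \in _](_ : _ = \sum_j c j *: b (h j)) //.
rewrite [RHS](partition_big h xpredT) //=; apply: eq_bigr => x _.
by rewrite scaler_suml; apply: eq_bigr => i /eqP->.
Qed.

End FamilyTheory.

Section Families.
Variables (K : fieldType) (A : falgType K).
Variables (disp : Order.disp_t) (L : finPOrderType disp) (M : L -> finType).

(* The labels (lambda, S, T) of a cellular basis. *)
Definition cell_index := {l : L & (M l * M l)%type}.

Variable B : forall l, M l -> M l -> A.

Definition family (x : cell_index) : A :=
  B (tagged x).1 (tagged x).2.

(* A(< l), respectively A(> l), for the family B. *)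
Definition span_lt (l : L) : {vspace A} :=
  <<[seq family x | x : cell_index in [pred x | (tag x < l)%O]]>>%VS.

Definition span_gt (l : L) : {vspace A} :=
  <<[seq family x | x : cell_index in [pred x | (l < tag x)%O]]>>%VS.

Definition label l (S T : M l) : cell_index :=
  Tagged (fun l => (M l * M l)%type) (S, T).

Lemma label_inj l (S T S' T' : M l) :
  (label S T == label S' T') = (S == S') && (T == T').
Proof. by rewrite eq_Tagged. Qed.

Lemma label_neq l m (S T : M l) (S' T' : M m) :
  l != m -> (label S T == label S' T') = false.
Proof. by apply: contraNF => /eqP/(congr1 tag)/= ->. Qed.

Lemma two_sided_coef (P : pred cell_index) l (x : A) (p q : M l -> K) S V :
    let N := <<[seq family x | x : cell_index in P]>>%VS in
    coef_free family -> (forall X Y : M l, ~~ P (label X Y)) ->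
    x - \sum_X p X *: B X V \in N -> x - \sum_Y q Y *: B S Y \in N ->
  x - p S *: B S V \in N /\ p S = q V.
Proof.
move=> N fB nP px qx.
pose c (j : M l * M l) := (j.2 == V)%:R * p j.1 - (j.1 == S)%:R * q j.2.
have c0 : forall j, c j = 0.
  apply: (free_subfamily_span (h := fun j => label j.1 j.2) fB _ (fun j => nP _ _)).
    by case=> [X Y] [X' Y'] /eqP; rewrite label_inj => /andP[/eqP/=-> /eqP/=->].
  have := memvB qx px; rewrite opprB addrC addrA subrK.
  rewrite [X in X \in _ -> _](_ : _ = \sum_j c j *: family (label j.1 j.2)) //.
  under [RHS]eq_bigr do rewrite scalerBl.
  rewrite [RHS]sumrB; congr (_ - _).
    rewrite -(pair_bigA _ (fun X Y => ((Y == V)%:R * p X) *: B X Y)) /=.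
    apply: eq_bigr => X _; rewrite (bigD1 V) //= eqxx mul1r big1 ?addr0 //.
    by move=> Y /negPf->; rewrite mul0r scale0r.
  rewrite -(pair_bigA _ (fun X Y => ((X == S)%:R * q Y) *: B X Y)) /=.
  rewrite [RHS](bigD1 S) //= [X in _ + X]big1 ?addr0.
    by apply: eq_bigr => Y _; rewrite eqxx mul1r.
  by move=> X /negPf XS; rewrite big1 // => Y _; rewrite XS mul0r scale0r.
have pS : p S = q V.
  by apply/eqP; rewrite -subr_eq0 -(c0 (S, V)) /c /= !eqxx !mul1r.
split=> //; move: px; rewrite (bigD1 S) //= big1 ?addr0 // => X /negPf XS.
have := c0 (X, V); rewrite /c /= eqxx XS mul1r mul0r subr0 => ->.
by rewrite scale0r.
Qed.

End Families.

(* The scalars r_a(S', S) of (C3) are kept as data: they are determined by the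
   rest of the datum, since M l is either empty or provides some T. *)
Record cell_datum (K : fieldType) (A : falgType K)
    (disp : Order.disp_t) (L : finPOrderType disp) := CellDatum {
  cell_M : L -> finType;
  cell_C : forall l, cell_M l -> cell_M l -> A;
  cell_inv : {linear A -> A};
  cell_r : forall l, A -> cell_M l -> cell_M l -> K;
  cell_basis : basis_of fullv [seq family cell_C x | x : cell_index cell_M];
  cell_invM : forall a b, cell_inv (a * b) = cell_inv b * cell_inv a;
  cell_invK : involutive cell_inv;
  cell_invC : forall l (S T : cell_M l), cell_inv (cell_C S T) = cell_C T S;
  cell_mulC : forall l (S T : cell_M l) (a : A),
    a * cell_C S T - \sum_(S' : cell_M l) cell_r a S' S *: cell_C S' T
      \in span_lt cell_C l
}.

Section CellModule.
Variables (K : fieldType) (A : falgType K).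
Variables (disp : Order.disp_t) (L : finPOrderType disp).
Variable cd : cell_datum A L.
Local Notation M := (cell_M cd).
Local Notation C := (@cell_C _ _ _ _ cd _).
Local Notation r := (@cell_r _ _ _ _ cd _).

Lemma cell_free : coef_free (family (@cell_C _ _ _ _ cd)).
Proof. exact: free_coef_free (basis_free (cell_basis cd)). Qed.

Lemma cell_C_free l (T : M l) (c : M l -> K) :
  \sum_S c S *: C S T \in span_lt (@cell_C _ _ _ _ cd) l -> forall S, c S = 0.
Proof.
pose h S : cell_index M := Tagged (fun l => (M l * M l)%type) (S, T).
move=> cP; apply: (free_subfamily_span (h := h) cell_free _ _ cP).
  by move=> S S' /eqP; rewrite eq_Tagged => /eqP[].
by move=> S; rewrite /= ltxx.
Qed.

Lemma span_lt_mul l (a x : A) :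
  x \in span_lt (@cell_C _ _ _ _ cd) l ->
  a * x \in span_lt (@cell_C _ _ _ _ cd) l.
Proof.
case/span_familyP => c ->; rewrite mulr_sumr; apply: memv_suml => -[m [S T]] /= ml.
rewrite -scalerAr memvZ //.
rewrite -[a * _](subrK (\sum_S' r a S' S *: C S' T)) memvD //.
  have /span_familyP[e ->] := cell_mulC S T a.
  apply: memv_suml => y ym; rewrite memvZ // mem_span_family //=.
  exact: lt_trans ml.
apply: memv_suml => S' _; rewrite memvZ //.
exact: (mem_span_family (family (@cell_C _ _ _ _ cd)) (x := Tagged _ (S', T))).
Qed.

Lemma cell_r_uniq l (T S : M l) (a : A) (c : M l -> K) :
  a * C S T - \sum_S' c S' *: C S' T \in span_lt (@cell_C _ _ _ _ cd) l ->
  forall S', r a S' S = c S'.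
Proof.
move=> h S'; apply/esym/eqP; rewrite -subr_eq0; apply/eqP.
apply: (@cell_C_free l T (fun S' => c S' - r a S' S)).
under eq_bigr do rewrite scalerBl.
rewrite sumrB.
have := memvB (cell_mulC S T a) h.
by rewrite opprB addrC addrA subrK.
Qed.

Lemma cell_r1 l (S S' : M l) : r 1 S' S = (S' == S)%:R.
Proof.
apply: (@cell_r_uniq l S S 1 (fun S' => (S' == S)%:R)).
rewrite mul1r (bigD1 S) //= eqxx scale1r big1 ?addr0 ?subrr ?mem0v //.
by move=> U /negPf->; rewrite scale0r.
Qed.

Lemma cell_rD l (S S' : M l) a b : r (a + b) S' S = r a S' S + r b S' S.
Proof.
apply: (@cell_r_uniq l S S (a + b) (fun S' => r a S' S + r b S' S)).
under eq_bigr do rewrite scalerDl.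
by rewrite mulrDl big_split /= opprD addrACA memvD ?cell_mulC.
Qed.

Lemma cell_rM l (S S' : M l) a b :
  r (a * b) S' S = \sum_(U : M l) r a S' U * r b U S.
Proof.
apply: (@cell_r_uniq l S S (a * b) (fun S' => \sum_U r a S' U * r b U S)).
have := span_lt_mul a (cell_mulC S S b).
rewrite mulrBr mulrA mulr_sumr => h.
rewrite -[X in X - _](subrK (\sum_U a * (r b U S *: C U S))) -addrA memvD //.
under [X in _ - X]eq_bigr do rewrite scaler_suml.
rewrite [X in _ - X]exchange_big /= -sumrB; apply: memv_suml => U _.
under eq_bigr do rewrite mulrC -scalerA.
by rewrite -scalerAr -scaler_sumr -scalerBr memvZ ?cell_mulC.
Qed.

Definition cell_module (l : L) : Type := {ffun M l -> K}.

HB.instance Definition _ l := GRing.Zmodule.on (cell_module l).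

(* a C_S = \sum_S' r_a(S', S) C_S', the vector w being \sum_S w S C_S. *)
Definition cell_act l (a : A) (w : cell_module l) : cell_module l :=
  [ffun S' => \sum_S r a S' S * w S].

Lemma cell_actA l a b (w : cell_module l) :
  cell_act a (cell_act b w) = cell_act (a * b) w.
Proof.
apply/ffunP => S; rewrite !ffunE.
under eq_bigr do rewrite ffunE mulr_sumr.
rewrite exchange_big; apply: eq_bigr => U _ /=.
by rewrite cell_rM mulr_suml; apply: eq_bigr => V _; rewrite mulrA.
Qed.

Lemma cell_act1 l : left_id 1 (@cell_act l).
Proof.
move=> w; apply/ffunP => S; rewrite ffunE (bigD1 S) //= cell_r1 eqxx mul1r.
rewrite big1 ?addr0 // => U US.
by rewrite cell_r1 eq_sym (negPf US) mul0r.
Qed.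

Lemma cell_actDr l : right_distributive (@cell_act l) +%R.
Proof.
move=> a v w; apply/ffunP => S; rewrite !ffunE -big_split /=.
by apply: eq_bigr => U _; rewrite ffunE mulrDr.
Qed.

Lemma cell_actDl l (w : cell_module l) :
  {morph (@cell_act l)^~ w : a b / a + b}.
Proof.
move=> a b; apply/ffunP => S; rewrite !ffunE -big_split /=.
by apply: eq_bigr => U _; rewrite cell_rD mulrDl.
Qed.

HB.instance Definition _ l := GRing.Zmodule_isLmodule.Build A (cell_module l)
  (@cell_actA l) (@cell_act1 l) (@cell_actDr l) (@cell_actDl l).

(* The scalar of the congruence C_ST C_UV = Phi(T, U) C_SV modulo A(< l); it
   exists by PhiP below, so the default 0 is not used. Same for Psi and PsiP. *)
Definition Phi l (T U : M l) : K :=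
  xget 0 [set c | forall S V : M l,
    C S T * C U V - c *: C S V \in span_lt (@cell_C _ _ _ _ cd) l]%classic.

Lemma cell_mulCl l (S T : M l) (a : A) :
  C S T * a - \sum_(T' : M l) r (cell_inv cd a) T' T *: C S T'
    \in span_lt (@cell_C _ _ _ _ cd) l.
Proof.
have /span_familyP[e] := cell_mulC T S (cell_inv cd a).
move/(congr1 (cell_inv cd)); rewrite linearB /= cell_invM cell_invK cell_invC.
rewrite !linear_sum /=; under eq_bigr do rewrite linearZ /= cell_invC.
move=> ->; apply: memv_suml => -[m [X Y]] ml.
rewrite linearZ /= memvZ // /family /= cell_invC.
exact: (mem_span_family (family (@cell_C _ _ _ _ cd)) (x := Tagged _ (Y, X))).
Qed.

Lemma PhiP l (S T U V : M l) :
  C S T * C U V - Phi T U *: C S V \in span_lt (@cell_C _ _ _ _ cd) l.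
Proof.
have key X Y := two_sided_coef cell_free _ (cell_mulC U Y (C X T))
  (cell_mulCl X T (C U Y)).
have {}key X Y : C X T * C U Y - r (C X T) X U *: C X Y
      \in span_lt (@cell_C _ _ _ _ cd) l /\ r (C X T) X U = r (C Y U) Y T.
  by rewrite -[in RHS]cell_invC; apply: key => ? ?; rewrite /= ltxx.
pose P := [set c | forall S V : M l,
  C S T * C U V - c *: C S V \in span_lt (@cell_C _ _ _ _ cd) l]%classic.
suff /(xgetPex 0) : exists c, P c by apply.
exists (r (C T T) T U) => X Y; have [_ ->] := key T Y.
by have [+ <-] := key X Y.
Qed.

End CellModule.

Section Frobenius.
Variables (K : fieldType) (A : falgType K).
Variables (disp : Order.disp_t) (L : finPOrderType disp).

Definition associative_form (f : {biscalar A}) : Prop :=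
  forall a b c, f (a * b) c = f a (b * c).

Definition nondegenerate_form (f : {biscalar A}) : Prop :=
  (forall a, (forall b, f a b = 0) -> a = 0) /\
  (forall b, (forall a, f a b = 0) -> b = 0).

Definition tau (f : {biscalar A}) (a : A) : K := f a 1.

Section Dual.
Variables (M : L -> finType) (C B : forall l, M l -> M l -> A).
Variable f : {biscalar A}.

(* The product of Kronecker deltas is an equality of labels because S and V
   live in different types when l and m differ. *)
Definition left_dual : Prop :=
  forall l m (S T : M l) (U V : M m),
    tau f (B U V * C S T) = (label U V == label T S)%:R.

Definition right_dual : Prop :=
  forall l m (S T : M l) (U V : M m),
    tau f (C S T * B U V) = (label U V == label T S)%:R.

Definition Psi l (T P : M l) : K :=
  xget 0 [set c | forall S Q : M l,
    B S T * B P Q - c *: B S Q \in span_gt B l]%classic.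

End Dual.

Section PsiP.
Variables (cd : cell_datum A L) (f : {biscalar A}).
Local Notation M := (cell_M cd).
Local Notation C := (@cell_C _ _ _ _ cd).
Local Notation r := (@cell_r _ _ _ _ cd _).
Variable D : forall l, M l -> M l -> A.
Hypotheses (fA : associative_form f) (fN : nondegenerate_form f).
Hypothesis DC : left_dual C D f.
Hypothesis iD : forall l (S T : M l), cell_inv cd (D S T) = D T S.

Lemma tau_sum (I : finType) (P : pred I) (c : I -> K) (F : I -> A) :
  tau f (\sum_(i | P i) c i *: F i) = \sum_(i | P i) c i * tau f (F i).
Proof.
by rewrite /tau linear_sumlz; apply: eq_bigr => i _; rewrite linearZl_LR.
Qed.

Lemma tauD a b : tau f (a + b) = tau f a + tau f b.
Proof. by rewrite /tau linearDl. Qed.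

Lemma tauB a b : tau f (a - b) = tau f a - tau f b.
Proof. by rewrite /tau linearBl. Qed.

Lemma dual_free : coef_free (family D).
Proof.
move=> c c0 [l [S T]].
have := congr1 (fun a => tau f (a * C T S)) c0.
rewrite mul0r mulr_suml; under eq_bigr do rewrite -scalerAl.
rewrite tau_sum [tau f 0]linear0l (bigD1 (label S T)) //=.
rewrite {1}/family /= DC eqxx mulr1 big1 ?addr0 //.
by move=> [m [U V]] ne; rewrite /family /= DC (negPf ne) mulr0.
Qed.

Definition swap_label (x : cell_index M) : cell_index M :=
  label (tagged x).2 (tagged x).1.

Lemma dual_expand a :
  a = \sum_x tau f (a * family C (swap_label x)) *: family D x.
Proof.
apply/eqP; rewrite -subr_eq0; apply/eqP; apply: (proj1 fN) => b.
rewrite -[b]mulr1 -fA -/(tau f _).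
have : b \in <<[seq family C x | x in predT]>>%VS.
  by rewrite (span_basis (cell_basis cd)) memvf.
case/span_familyP => e ->; rewrite mulr_sumr; under eq_bigr do rewrite -scalerAr.
rewrite tau_sum big1 // => -[l [S T]] _; apply/eqP; rewrite mulf_eq0; apply/orP.
right; rewrite mulrBl tauB subr_eq0; apply/eqP.
rewrite mulr_suml; under [in RHS]eq_bigr do rewrite -scalerAl.
rewrite tau_sum (bigD1 (label T S)) //= {3}/family /= DC eqxx mulr1.
rewrite big1 ?addr0 // => -[m [U V]] ne.
by rewrite {2 3}/family /= DC (negPf ne) mulr0.
Qed.

Lemma dual_mulr l (S T : M l) (a : A) :
  D S T * a - \sum_V r a T V *: D S V \in span_gt D l.
Proof.
rewrite [X in X \in _]dual_expand; apply: memv_suml => -[m [U V]] _.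
rewrite /family /=.
have [lm|nlm] := boolP (l < m)%O.
  by rewrite memvZ // (mem_span_family (family D) (x := label U V)).
rewrite [X in X *: _](_ : _ = 0) ?scale0r ?mem0v //.
rewrite mulrBl tauB -mulrA.
rewrite -[a * _](subrK (\sum_S' r a S' V *: C S' U)) mulrDr.
rewrite tauD.
have /span_familyP[e ->] := cell_mulC V U a.
rewrite mulr_sumr; under [X in tau f X + _]eq_bigr do rewrite -scalerAr.
rewrite tau_sum big1 ?add0r; last first.
  move=> [n [X Y]] /= nm; rewrite /family /= DC label_neq ?mulr0 //.
  by apply: contraNneq nlm => ->.
rewrite mulr_sumr mulr_suml.
under [X in tau f X - _]eq_bigr do rewrite -scalerAr; rewrite tau_sum.
under [X in _ - tau f X]eq_bigr do rewrite -scalerAl; rewrite tau_sum.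
have [e0|ne] := eqVneq l m; last first.
  by rewrite !big1 ?subrr // => X _; rewrite DC label_neq ?mulr0.
case: m / e0 U V nlm e => U V _ _; apply/eqP; rewrite subr_eq0; apply/eqP.
rewrite (bigD1 T) //= DC label_inj eqxx andbT big1 ?addr0; last first.
  by move=> X XT; rewrite DC label_inj (eq_sym T) (negPf XT) andbF mulr0.
rewrite (bigD1 V) //= DC label_inj eqxx andbT big1 ?addr0 //.
by move=> X XV; rewrite DC label_inj (negPf XV) andbF mulr0.
Qed.

Lemma dual_mull l (S T : M l) (a : A) :
  a * D S T - \sum_V r (cell_inv cd a) S V *: D V T \in span_gt D l.
Proof.
have /span_familyP[e] := dual_mulr T S (cell_inv cd a).
move/(congr1 (cell_inv cd)); rewrite linearB /= cell_invM cell_invK iD.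
rewrite !linear_sum /=; under eq_bigr do rewrite linearZ /= iD.
move=> ->; apply: memv_suml => -[m [X Y]] ml.
rewrite linearZ /= memvZ // /family /= iD.
exact: (mem_span_family (family D) (x := label Y X)).
Qed.

Lemma PsiP l (S T P Q : M l) :
  D S T * D P Q - Psi D T P *: D S Q \in span_gt D l.
Proof.
have key X Y := two_sided_coef dual_free _ (dual_mull P Y (D X T))
  (dual_mulr X T (D P Y)).
have {}key X Y : D X T * D P Y - r (D T X) P X *: D X Y
      \in span_gt D l /\ r (D T X) P X = r (D P Y) T Y.
  by rewrite -[in D T X]iD; apply: key => ? ?; rewrite /= ltxx.
pose H := [set c | forall S Q : M l,
  D S T * D P Q - c *: D S Q \in span_gt D l]%classic.
suff /(xgetPex 0) : exists c, H c by apply.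
exists (r (D T T) P T) => X Y; have [_ ->] := key T Y.
by have [+ <-] := key X Y.
Qed.

End PsiP.

Definition k_const (cd : cell_datum A L)
    (D : forall l, cell_M cd l -> cell_M cd l -> A) l (T : cell_M cd l) : K :=
  \sum_(X : cell_M cd l) Phi X T * Psi D X T.

End Frobenius.

Definition projective_module (R : pzRingType) (P : lmodType R) : Prop :=
  forall (M N : lmodType R) (g : {linear M -> N}) (h : {linear P -> N}),
    (forall y, exists x, g x = y) ->
    exists h' : {linear P -> M}, forall x, g (h' x) = h x.

(* Main.v *)
(* Since D and C are tau-dual, tau (D_{VX} a C_{UV}) is the matrix coefficient
   r_a(X, U), and D_{PQ} C_{ST} (both labels in M l) vanishes unless Q = S and
   does not depend on Q = S. Applying the involution, C_{SQ} D_{QP} does not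
   depend on Q either; it acts on the cell module as an elementary matrix times
   \sum_U Phi(Q, U) Psi(U, Q), so the matrix product Phi Psi is the scalar
   k_l.
   If k_l is nonzero, C_S |-> C_{SP} D_{PP} is an A-linear map W -> A, and
   followed by a |-> a C_P it is multiplication by k_l, so W is a direct summand
   of A. Conversely every A-linear s : W -> A satisfies
   s(C_U) C_V = k_l tau(s(C_V)) C_U; if k_l = 0, each such s(w) kills W, so the
   surjection A^{M l} -> W, (a_S) |-> \sum_S a_S C_S, does not split. *)
Require Import Defs.
From HB Require Import structures.
From mathcomp Require Import all_boot all_order all_algebra all_field.

Set Implicit Arguments.
Unset Strict Implicit.
Unset Printing Implicit Defensive.

Import Order.TTheory GRing.Theory.
Local Open Scope ring_scope.

(** * Coordinates and matrix coefficients on the cell module *)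

Section CellModuleBasis.
Variables (K : fieldType) (A : falgType K).
Variables (disp : Order.disp_t) (L : finPOrderType disp).
Variables (cd : cell_datum A L) (l : L).

Lemma cell_scaleE (a : A) (w : cell_module cd l) X :
  (a *: w) X = \sum_S cell_r a X S * w S.
Proof. by rewrite ffunE. Qed.

Definition cell_vec (S : cell_M cd l) : cell_module cd l :=
  [ffun X => (X == S)%:R].

Lemma cell_scale_vec (a : A) S X : (a *: cell_vec S) X = cell_r a X S.
Proof.
rewrite cell_scaleE (bigD1 S) //= ffunE eqxx mulr1 big1 ?addr0 // => U US.
by rewrite ffunE (negPf US) mulr0.
Qed.

(** The module structure on [cell_module] is over [A] alone, so scalars of K act through [c%:A]. *)
Lemma cell_rZ1 (c : K) (S S' : cell_M cd l) :
  cell_r (c%:A : A) S' S = c * (S' == S)%:R.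
Proof.
apply: (@cell_r_uniq _ _ _ _ cd l S S c%:A (fun S' => c * (S' == S)%:R)).
rewrite mulr_algl (bigD1 S) //= eqxx mulr1 big1 ?addr0 ?subrr ?mem0v //.
by move=> U /negPf->; rewrite mulr0 scale0r.
Qed.

Lemma cell_vec_sum (w : cell_module cd l) :
  w = \sum_S ((w S)%:A : A) *: cell_vec S.
Proof.
apply/ffunP => X; rewrite sum_ffunE (bigD1 X) //= cell_scale_vec cell_rZ1 eqxx.
rewrite mulr1 big1 ?addr0 // => S SX.
by rewrite cell_scale_vec cell_rZ1 eq_sym (negPf SX) mulr0.
Qed.

Lemma cell_linear_sum (s : {linear cell_module cd l -> A^o}) w :
  s w = \sum_S w S *: (s (cell_vec S) : A).
Proof.
rewrite {1}[w]cell_vec_sum linear_sum; apply: eq_bigr => S _.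
by rewrite linearZ; exact: (mulr_algl (w S) (s (cell_vec S) : A)).
Qed.

Lemma sum_cell_index (M : L -> finType) (F : cell_index M -> K) :
    (forall x, tag x != l -> F x = 0) ->
  \sum_x F x = \sum_(S : M l) \sum_(T : M l) F (label S T).
Proof.
move=> F0; rewrite pair_bigA /=.
have -> : \sum_x F x = \sum_m \sum_(p : M m * M m)
    F (Tagged (fun m => (M m * M m)%type) p).
  by rewrite sig_big_dep; apply: eq_bigr => -[].
rewrite (bigD1 l) //= [X in _ + X]big1 ?addr0.
  by apply: eq_bigr => -[].
by move=> m ml; rewrite big1 // => p _; rewrite F0.
Qed.

End CellModuleBasis.

Section FrobeniusCellular.
Variables (K : fieldType) (A : falgType K).
Variables (disp : Order.disp_t) (L : finPOrderType disp).
Variables (cd : cell_datum A L) (f : {biscalar A}).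
Local Notation M := (cell_M cd).
Local Notation C := (@cell_C _ _ _ _ cd _).
Local Notation inv := (cell_inv cd).
Variable D : forall l, M l -> M l -> A.
Hypotheses (fA : associative_form f) (fN : nondegenerate_form f).
Hypothesis DC : left_dual (@cell_C _ _ _ _ cd) D f.
Hypothesis iD : forall l (S T : M l), inv (D S T) = D T S.

(** * Duality of the two bases under [tau] *)

Lemma tau_dual_span_lt l m (U V : M m) z :
  ~~ (m < l)%O -> z \in span_lt (@cell_C _ _ _ _ cd) l -> tau f (D U V * z) = 0.
Proof.
move=> ml /span_familyP[e ->]; rewrite mulr_sumr.
under eq_bigr do rewrite -scalerAr.
rewrite tau_sum big1 // => -[n [X Y]] /= nl; rewrite /Defs.family /= DC label_neq.
  by rewrite mulr0.
by apply: contraNneq ml => ->.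
Qed.

Lemma tau_span_gt_cell l m (S T : M m) z :
  ~~ (l < m)%O -> z \in span_gt D l -> tau f (z * C S T) = 0.
Proof.
move=> ml /span_familyP[e ->]; rewrite mulr_suml.
under eq_bigr do rewrite -scalerAl.
rewrite tau_sum big1 // => -[n [X Y]] /= ln; rewrite /Defs.family /= DC label_neq.
  by rewrite mulr0.
by apply: contraNneq ml => <-.
Qed.

Lemma cell_expand a :
  a = \sum_x tau f (Defs.family D (swap_label x) * a) *:
             Defs.family (@cell_C _ _ _ _ cd) x.
Proof.
have : a \in <<[seq Defs.family (@cell_C _ _ _ _ cd) x | x in predT]>>%VS.
  by rewrite (span_basis (cell_basis cd)) memvf.
case/span_familyP => e ->; apply: eq_bigr => -[l [S T]] _; congr (_ *: _).
rewrite mulr_sumr; under eq_bigr do rewrite -scalerAr.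
rewrite tau_sum (bigD1 (label S T)) //= {1 2}/Defs.family /= DC eqxx mulr1.
rewrite big1 ?addr0 // => -[m [U V]] ne; rewrite /Defs.family /= DC.
case: eqP => [E|]; last by rewrite mulr0.
case/eqP: ne; have := congr1 (@swap_label _ _ _ _ cd) E.
by rewrite /swap_label /= => ->.
Qed.

Lemma tau_dual_inj a b :
  (forall m (X Y : M m), tau f (D X Y * a) = tau f (D X Y * b)) -> a = b.
Proof.
by move=> ab; rewrite [a]cell_expand [b]cell_expand; apply: eq_bigr => x _; rewrite ab.
Qed.

(** Pairing with [D V X] kills A(< l) and picks out the coefficient of [C X V]. *)
Lemma cell_r_tau l (X U V : M l) a : cell_r a X U = tau f (D V X * (a * C U V)).
Proof.
rewrite -[a * _](subrK (\sum_S' cell_r a S' U *: C S' V)) mulrDr tauD.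
rewrite (@tau_dual_span_lt l) ?ltxx ?cell_mulC // add0r mulr_sumr.
under eq_bigr do rewrite -scalerAr.
rewrite tau_sum (bigD1 X) //= DC eqxx mulr1 big1 ?addr0 // => S SX.
by rewrite DC label_inj (eq_sym X) (negPf SX) andbF mulr0.
Qed.

(** * Products of dual and cellular basis elements *)

Lemma tau_dual_cell l (P Q S T : M l) a :
  tau f (a * (D P Q * C S T)) = (Q == S)%:R * cell_r (inv a) P T.
Proof.
(* Modulo higher terms, which pair to zero with [C S T], left multiplication leaves the second index
   [Q] unchanged; so [Q] survives only in a Kronecker delta. *)
rewrite mulrA -[a * _](subrK (\sum_V cell_r (inv a) P V *: D V Q)) mulrDl tauD.
rewrite (@tau_span_gt_cell l) ?ltxx ?(dual_mull fA fN DC iD) // add0r mulr_suml.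
under eq_bigr do rewrite -scalerAl.
rewrite tau_sum (bigD1 T) //= DC label_inj eqxx big1 ?addr0 1?mulrC // => V VT.
by rewrite DC label_inj (negPf VT) mulr0.
Qed.

(** Only dual basis elements with label at least [l] occur in [a * D P Q], and none of them has
    label [m]. *)
Lemma tau_dual_cell0 l m (P Q : M l) (S T : M m) a :
  ~~ (l <= m)%O -> tau f (a * (D P Q * C S T)) = 0.
Proof.
move=> lm; rewrite mulrA -[a * _](subrK (\sum_V cell_r (inv a) P V *: D V Q)).
rewrite mulrDl tauD (@tau_span_gt_cell l) ?(dual_mull fA fN DC iD) //; last first.
  by apply: contra lm => /ltW.
rewrite add0r mulr_suml; under eq_bigr do rewrite -scalerAl.
rewrite tau_sum big1 // => V _; rewrite DC label_neq ?mulr0 //.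
by apply: contraNneq lm => ->.
Qed.

Lemma dual_cell_eq0 l m (P Q : M l) (S T : M m) :
  ~~ (l <= m)%O -> D P Q * C S T = 0.
Proof.
move=> lm; apply: tau_dual_inj => n X Y.
by rewrite tau_dual_cell0 // mulr0 [tau f 0]linear0l.
Qed.

Lemma dual_cell_neq l (P Q S T : M l) : Q != S -> D P Q * C S T = 0.
Proof.
move=> QS; apply: tau_dual_inj => n X Y.
by rewrite tau_dual_cell (negPf QS) mul0r mulr0 [tau f 0]linear0l.
Qed.

Lemma dual_cell_indep l (P Q S T : M l) : D P Q * C Q T = D P S * C S T.
Proof. by apply: tau_dual_inj => n X Y; rewrite !tau_dual_cell !eqxx. Qed.

Lemma cell_dual_inv l m (P Q : M l) (S T : M m) :
  C T S * D Q P = inv (D P Q * C S T).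
Proof. by rewrite cell_invM iD cell_invC. Qed.

(** * [Phi] and [Psi] as matrices acting on the cell module *)

Lemma cell_r_cell l (S T X U : M l) :
  cell_r (C S T) X U = (X == S)%:R * Phi T U.
Proof.
apply: (@cell_r_uniq _ _ _ _ cd l S U (C S T) (fun X => (X == S)%:R * Phi T U)).
rewrite (bigD1 S) //= eqxx mul1r big1 ?addr0 ?PhiP // => Y /negPf->.
by rewrite mul0r scale0r.
Qed.

(** Modulo higher terms [D U X * D T S] is [Psi D X T *: D U S], and pairing this with [C U U]
    leaves the delta. *)
Lemma cell_r_dual l (T S X U : M l) :
  cell_r (D T S) X U = (S == U)%:R * Psi D X T.
Proof.
rewrite (cell_r_tau X U U) mulrA -[D U X * _](subrK (Psi D X T *: D U S)).
rewrite mulrDl tauD (@tau_span_gt_cell l) ?ltxx ?(PsiP fA fN DC iD) // add0r.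
rewrite -scalerAl /tau linearZl_LR /= [f _ _]DC label_inj eqxx /=.
exact: mulrC.
Qed.

(** The coefficient of [C T T] in [C T S * C T T] is computed twice, expanding the product by the
    left action and by the right action. *)
Lemma Phi_sym l (S T : M l) : Phi S T = Phi T S.
Proof.
have := cell_r_tau T T T (C T S); rewrite cell_r_cell eqxx mul1r => ->.
rewrite -[C T S * _](subrK (\sum_T' cell_r (inv (C T T)) T' S *: C T T')).
rewrite mulrDr tauD (@tau_dual_span_lt l) ?ltxx ?cell_mulCl // add0r mulr_sumr.
under eq_bigr do rewrite -scalerAr.
rewrite tau_sum (bigD1 T) //= DC eqxx mulr1 cell_invC cell_r_cell eqxx mul1r.
rewrite big1 ?addr0 // => X XT.
by rewrite DC label_inj (eq_sym T) (negPf XT) mulr0.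
Qed.

(** The scalar [tau f (D S S * (D T S * C S S))] is read once as a matrix entry of [D T S], once by
    letting [D S S] act on [D T S] from the left. *)
Lemma Psi_sym l (S T : M l) : Psi D S T = Psi D T S.
Proof.
have := cell_r_tau S S S (D T S); rewrite cell_r_dual eqxx mul1r => ->.
by rewrite tau_dual_cell iD cell_r_dual !eqxx !mul1r.
Qed.

Lemma cell_r_cell_dual l (S Q P T X Y : M l) :
  cell_r (C S Q * D P T) X Y =
  (X == S)%:R * (T == Y)%:R * \sum_U Phi Q U * Psi D U P.
Proof.
rewrite cell_rM mulr_sumr; apply: eq_bigr => U _.
by rewrite cell_r_cell cell_r_dual mulrACA.
Qed.

Lemma Phi_Psi l (Q P T : M l) :
  \sum_U Phi Q U * Psi D U P = (Q == P)%:R * k_const D T.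
Proof.
have -> : k_const D T = \sum_U Phi T U * Psi D U T.
  by apply: eq_bigr => U _; rewrite Phi_sym.
(* Each sum is the [(T, T)] entry of a product [C T Q' * D P' T], which vanishes for [Q' != P'] and
   otherwise does not depend on [Q']. Since [T] is free, [k_const D T] is the same for all [T]. *)
have E (Q' P' : M l) : \sum_U Phi Q' U * Psi D U P' =
    cell_r (C T Q' * D P' T) T T by rewrite cell_r_cell_dual !eqxx !mul1r.
rewrite !E; have [<-|QP] := eqVneq Q P.
  by rewrite mul1r !cell_dual_inv (dual_cell_indep T Q T).
rewrite mul0r cell_dual_inv dual_cell_neq 1?eq_sym // linear0.
by rewrite (cell_r_tau T T T) mul0r mulr0 [tau f 0]linear0l.
Qed.

(** * Nonzero constant: the cell module as a summand of [A] *)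

Section Embedding.
Variables (l : L) (P : M l).

Definition cell_embed (w : cell_module cd l) : A :=
  \sum_S w S *: (C S P * D P P).

Lemma cell_embed_act a w : cell_embed (a *: w) = a * cell_embed w.
Proof.
rewrite /cell_embed mulr_sumr.
under eq_bigr do rewrite cell_scaleE scaler_suml.
rewrite exchange_big; apply: eq_bigr => S _ /=.
under eq_bigr do rewrite mulrC -scalerA.
rewrite -scaler_sumr -scalerAr; congr (_ *: _); rewrite mulrA.
rewrite -[a * _](subrK (\sum_S' cell_r a S' S *: C S' P)) mulrDl.
(* The error terms from A(< l) are annihilated by right multiplication by [D P P], so the congruence
   (C3) becomes an equality. *)
have /span_familyP[e ->] := cell_mulC S P a.
rewrite mulr_suml [X in _ = X + _]big1 ?add0r.
  by rewrite mulr_suml; apply: eq_bigr => X _; rewrite scalerAl.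
move=> [m [X Y]] /= ml; rewrite -scalerAl /Defs.family /= cell_dual_inv.
by rewrite dual_cell_eq0 ?linear0 ?scaler0 // lt_geF.
Qed.

Lemma cell_embed_vec w :
  cell_embed w *: cell_vec P = ((k_const D P)%:A : A) *: w.
Proof.
rewrite [in RHS](cell_vec_sum w) scaler_sumr /cell_embed scaler_suml.
apply: eq_bigr => S _; rewrite -[w S *: (_ * _)]mulr_algl -scalerA.
have -> : (C S P * D P P) *: cell_vec P = ((k_const D P)%:A : A) *: cell_vec S.
  apply/ffunP => X; rewrite !cell_scale_vec cell_rZ1 cell_r_cell_dual.
  by rewrite (Phi_Psi P P P) !eqxx mulr1 mul1r mulrC.
by rewrite !scalerA !mulr_algl !scalerA mulrC.
Qed.

End Embedding.

Lemma projective_of_k_const l (T : M l) :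
  k_const D T != 0 -> projective_module (cell_module cd l).
Proof.
move=> k0 N N' g h gsurj.
(* For any [n] the map [w |-> cell_embed T w *: n] is linear; the inverse in the choice of [n]
   cancels the factor produced by [cell_embed_vec]. *)
have [n gn] := gsurj ((((k_const D T)^-1)%:A : A) *: h (cell_vec T)).
have lin : linear (fun w => cell_embed T w *: n).
  move=> a v w /=; rewrite scalerA -cell_embed_act -scalerDl; congr (_ *: _).
  rewrite /cell_embed -big_split; apply: eq_bigr => S _.
  by rewrite /= -scalerDl ffunE.
pose s : {linear cell_module cd l -> N} := HB.pack (fun w => cell_embed T w *: n)
  (GRing.isLinear.Build _ _ _ _ (fun w => cell_embed T w *: n) lin).
exists s => w; rewrite /s /= linearZ /= gn scalerA mulr_algr -mulr_algl -scalerA.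
rewrite -[X in _ *: X]linearZ_LR cell_embed_vec linearZ_LR.
by rewrite scalerA mulr_algl scalerA mulVf // !scale1r.
Qed.

(** * Projectivity forces a nonzero constant *)

Lemma cell_r_eq0 l m (S T : M m) (X U : M l) :
  ~~ (l <= m)%O -> cell_r (C S T) X U = 0.
Proof.
move=> lm; rewrite (cell_r_tau X U U).
(* Expanded by the right action, the product has only labels at most [m], so [l] does not occur. *)
rewrite -[C S T * _](subrK (\sum_V cell_r (inv (C U U)) V T *: C S V)).
rewrite mulrDr tauD (@tau_dual_span_lt m) ?cell_mulCl //; last first.
  by apply: contra lm => /ltW.
rewrite add0r mulr_sumr; under eq_bigr do rewrite -scalerAr.
rewrite tau_sum big1 // => V _; rewrite DC label_neq ?mulr0 //.
by apply: contraNneq lm => ->.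
Qed.

Lemma dual_r_eq0 l m (S T : M m) (X U : M l) :
  ~~ (m <= l)%O -> cell_r (D S T) X U = 0.
Proof. by move=> ml; rewrite (cell_r_tau X U U) tau_dual_cell0. Qed.

Lemma cell_hom_act l (T : M l) (s : {linear cell_module cd l -> A^o}) U X V :
  cell_r (s (cell_vec U)) X V =
  (X == U)%:R * (k_const D T * tau f (s (cell_vec V))).
Proof.
have coef a (W : M l) : tau f (a * s (cell_vec W)) =
    \sum_Y cell_r a Y W * tau f (s (cell_vec Y)).
  have -> : a * s (cell_vec W) = s (a *: cell_vec W) by rewrite linearZ.
  rewrite cell_linear_sum tau_sum.
  by apply: eq_bigr => Y _; rewrite cell_scale_vec.
rewrite (cell_r_tau X V V) [s (cell_vec U)]cell_expand mulr_suml mulr_sumr.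
under eq_bigr do rewrite -scalerAl -scalerAr.
(* The coefficient at label [m] vanishes unless [m <= l], and [C S S'] acts as zero unless [l <= m];
   only [m = l] remains. *)
rewrite tau_sum (sum_cell_index (l := l)); last first.
  move=> [m [S S']] /= ml; rewrite -cell_r_tau /Defs.family /=.
  have [lm|lm] := boolP (l <= m)%O; last by rewrite cell_r_eq0 ?mulr0.
  rewrite coef big1 ?mul0r // => Y _; rewrite dual_r_eq0 ?mul0r //.
  by rewrite lt_geF // lt_neqAle eq_sym ml.
under eq_bigr => S _ do under eq_bigr => S' _ do
  rewrite -cell_r_tau /Defs.family /= cell_r_cell coef.
rewrite (bigD1 X) //= [X in _ + X]big1 ?addr0; last first.
  by move=> S SX; apply: big1 => S' _; rewrite eq_sym (negPf SX) mul0r mulr0.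
under eq_bigr => S' _ do rewrite eqxx mul1r mulr_suml.
rewrite exchange_big /=.
(* The symmetries of [Phi] and [Psi] turn the inner sum into an entry of the matrix product, which
   [Phi_Psi] makes zero unless [Y = V]. *)
transitivity (\sum_Y (X == U)%:R * tau f (s (cell_vec Y)) *
    \sum_S' Phi V S' * Psi D S' Y).
  apply: eq_bigr => Y _; rewrite mulr_sumr; apply: eq_bigr => S' _.
  rewrite cell_r_dual Phi_sym Psi_sym -!mulrA; congr (_ * _).
  by rewrite mulrCA; congr (_ * _); apply: mulrC.
rewrite (bigD1 V) //= (Phi_Psi V V T) eqxx mul1r big1 ?addr0.
  by rewrite -mulrA; congr (_ * _); apply: mulrC.
by move=> Y YV; rewrite (Phi_Psi V Y T) (eq_sym V) (negPf YV) mul0r mulr0.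
Qed.

Lemma k_const_of_projective l (T : M l) :
  projective_module (cell_module cd l) -> k_const D T != 0.
Proof.
move=> projW; apply/eqP => k0.
pose F : lmodType A := {ffun M l -> A^o}.
pose g0 (a : F) : cell_module cd l := \sum_S (a S : A) *: cell_vec S.
have lin : linear g0.
  move=> c a b; rewrite /g0 scaler_sumr -big_split; apply: eq_bigr => S _.
  by rewrite !ffunE scalerDl scalerA.
pose g : {linear F -> cell_module cd l} :=
  HB.pack g0 (GRing.isLinear.Build _ _ _ _ g0 lin).
have [w|s gs] := projW F _ g idfun.
  exists ([ffun S => (w S)%:A] : F); rewrite /g /= /g0 [RHS]cell_vec_sum.
  by apply: eq_bigr => S _; rewrite ffunE.
(* Each coordinate of the section [s] is a homomorphism to [A], whose values kill every [cell_vec S]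
   as the constant is zero; hence [g (s (cell_vec T))] is zero. *)
have : cell_vec T T = 0.
  rewrite -[cell_vec T]gs /g /= /g0 sum_ffunE big1 // => S _.
  rewrite cell_scale_vec.
  have slin : linear (fun w => s w S : A^o).
    by move=> a v w; rewrite linearP !ffunE.
  pose sS : {linear cell_module cd l -> A^o} :=
    HB.pack (fun w => s w S : A^o)
      (GRing.isLinear.Build _ _ _ _ (fun w => s w S : A^o) slin).
  by have := cell_hom_act T sS T T S; rewrite k0 mul0r mulr0.
by rewrite ffunE eqxx => /eqP; rewrite oner_eq0.
Qed.

End FrobeniusCellular.

Theorem theorem4p6 (K : fieldType) (A : falgType K)
    (disp : Order.disp_t) (L : finPOrderType disp) (cd : cell_datum A L)
    (f : {biscalar A})
    (f_assoc : associative_form f) (f_nondeg : nondegenerate_form f)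
    (D d : forall l : L, cell_M cd l -> cell_M cd l -> A)
    (D_dual : left_dual (@cell_C _ _ _ _ cd) D f)
    (d_dual : right_dual (@cell_C _ _ _ _ cd) d f)
    (inv_D : forall (l : L) (S T : cell_M cd l), cell_inv cd (D l S T) = D l T S)
    (inv_d : forall (l : L) (S T : cell_M cd l), cell_inv cd (d l S T) = d l T S)
    (l : L) (T : cell_M cd l) :
  projective_module (cell_module cd l) <-> k_const D T != 0.
Proof.
split; first exact: k_const_of_projective f_assoc f_nondeg D_dual inv_D _ _.
exact: projective_of_k_const f_assoc f_nondeg D_dual inv_D _ _.
Qed.
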